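(* Let $A\in\mathcal{M}_{t\times\infty}(S_{>0})$ be a nondegenerate regular array. Then the weight ideal $I_A$ is generated, as a two-sided ideal of $R=k\langle x_1,\dots,x_t\rangle$, by the union of the set of commutators $\{x_ix_j-x_jx_i : 1\le i\ne j\le t\}$ and the set $\mathcal{M}_A$ of minimal homogeneous binomial differences of disjoint support associated to $A$.
   Context: Let $k$ be a field, $t\ge 1$, and $R=k\langle x_1,\dots,x_t\rangle$ the free associative algebra. Let $\mathcal{B}$ be the set of all words in $x_1,\dots,x_t$ (including the trivial/empty word) and $\mathcal{B}^{\times}$ the set of nontrivial words; $|\omega|$ is the length of a word $\omega$. Let $S_{>0}$ be the set of positive elements of a totally ordered field and $\mathcal{M}_{t\times\infty}(S_{>0})$ the set of $t\times\infty$ arrays $A=(a_{i,j})$, $1\le i\le t$, $j\ge 0$ (columns are indexed starting from $0$), with entries in $S_{>0}$. The weight function of $A$ is $\sigma(x_{u_0}x_{u_1}\cdots x_{u_{l-1}})=\prod_{j=0}^{l-1}a_{u_j,j}$. The weight ideal $I_A$ is the two-sided ideal of $R$ generated by all differences $\omega_1-\omega_2$ with $\omega_1,\omega_2\in\mathcal{B}^{\times}$, $|\omega_1|=|\omega_2|$ and $\sigma(\omega_1)=\sigma(\omega_2)$. $A$ is nondegenerate if $\sigma(x_i)\ne\sigma(x_j)$ for all $i\neq j$. $A$ is regular if it has rank $1$ (every column is a scalar multiple of the first column). The support $\mathrm{supp}(\omega)$ of a word $\omega$ is the set of letters $x_i$ occurring in $\omega$. A homogeneous binomial difference is an element $\omega_1-\omega_2$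 with $\omega_1,\omega_2$ words of equal length. A homogeneous binomial difference of disjoint support is a homogeneous binomial difference $\omega_1-\omega_2\in I_A$ with $\mathrm{supp}(\omega_1)\cap\mathrm{supp}(\omega_2)=\emptyset$. A homogeneous binomial difference of disjoint support $\omega_1-\omega_2$ is minimal if every expression $\omega_1-\omega_2=\sum_{i=1}^n\alpha_i(u_i-v_i)\beta_i$, with $\alpha_i,\beta_i\in R$ and each $u_i-v_i$ a homogeneous binomial difference in $I_A$, contains at least one $u_i-v_i$ with $|u_i|=|v_i|=|\omega_1|$. $\mathcal{M}_A$ denotes the set of minimal homogeneous binomial differences of disjoint support. *)

(* Defs.v *)
From HB Require Import structures.
From mathcomp Require Import all_boot all_order all_algebra.
From mathcomp.multinomials Require Import monalg.

Set Implicit Arguments.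
Unset Strict Implicit.
Unset Printing Implicit Defensive.

Import Order.TTheory GRing.Theory Num.Theory.
Local Open Scope ring_scope.

Section TwoSidedIdeals.
Variable R : nzRingType.

Definition two_sided_ideal (J : R -> Prop) : Prop :=
  [/\ J 0, forall p q, J p -> J q -> J (p + q)
    & forall a p b, J p -> J (a * p * b)].

Definition ideal_generated (G : R -> Prop) (p : R) : Prop :=
  exists (n : nat) (a g b : 'I_n -> R),
    (forall i, G (g i)) /\ p = \sum_(i < n) a i * g i * b i.

Lemma ideal_generated_sub (G : R -> Prop) p : G p -> ideal_generated G p.
Proof.
move=> Gp; exists 1%N, (fun=> 1), (fun=> p), (fun=> 1); split=> //.
by rewrite big_ord1 mul1r mulr1.
Qed.

Lemma ideal_generated_ideal (G : R -> Prop) :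
  two_sided_ideal (ideal_generated G).
Proof.
split=> [|p q|c p d].
- by exists 0%N, (fun=> 0), (fun=> 0), (fun=> 0); split; [case | rewrite big_ord0].
- move=> [m [a [g [b [Gg ->]]]]] [n [a' [g' [b' [Gg' ->]]]]].
  pose glue (f : 'I_m -> R) f' (i : 'I_(m + n)) :=
    match split i with inl j => f j | inr j => f' j end.
  exists (m + n)%N, (glue a a'), (glue g g'), (glue b b'); split.
    by move=> i; rewrite /glue; case: (split i).
  rewrite big_split_ord /=; congr (_ + _); apply: eq_bigr => i _; rewrite /glue.
    by rewrite (unsplitK (inl i)).
  by rewrite (unsplitK (inr i)).
- move=> [m [a [g [b [Gg ->]]]]].
  exists m, (fun i => c * a i), g, (fun i => b i * d); split=> //.
  rewrite mulr_sumr mulr_suml; apply: eq_bigr => i _.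
  by rewrite !mulrA.
Qed.

Lemma ideal_generated_min (G J : R -> Prop) :
  two_sided_ideal J -> (forall p, G p -> J p) ->
  forall p, ideal_generated G p -> J p.
Proof.
move=> [J0 JD JM] GJ p [n [a [g [b [Gg ->]]]]].
by apply: (big_ind J) => // i _; apply: JM; apply: GJ.
Qed.

End TwoSidedIdeals.


Section WeightIdeal.
Variables (k : fieldType) (S : realFieldType) (t : nat).
Local Notation R := {malg k[{fmonom 'I_t}]}.
Implicit Types (w u v : {fmonom 'I_t}) (p : R) (A : 'I_t -> nat -> S).

Definition letter (i : 'I_t) : {fmonom 'I_t} := fmu i.
Definition mon w : R := << w >>.
Definition binom_diff u v : R := mon u - mon v.

(* The weight of the empty word is the empty product 1. *)
Definition weight A w : S :=
  \prod_(j < size w) A (tnth (in_tuple w) j) j.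

Definition weight_generator A p : Prop :=
  exists u v, [/\ u != mone, v != mone, fdeg u = fdeg v,
                  weight A u = weight A v & p = binom_diff u v].

Definition weight_ideal A : R -> Prop := ideal_generated (weight_generator A).

Definition nondegenerate_array A : Prop :=
  forall i j : 'I_t, i != j -> weight A (letter i) != weight A (letter j).

Definition regular_array A : Prop :=
  forall j : nat, exists c : S, forall i : 'I_t, A i j = c * A i 0%N.

Definition supp w : {set 'I_t} := [set i in (w : seq 'I_t)].

Definition homog_binom_in_ideal A u v : Prop :=
  fdeg u = fdeg v /\ weight_ideal A (binom_diff u v).

Definition disjoint_binom A u v : Prop :=
  homog_binom_in_ideal A u v /\ supp u :&: supp v = set0.

Definition minimal_disjoint_binom A w1 w2 : Prop :=
  disjoint_binom A w1 w2 /\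
  forall (n : nat) (a b : 'I_n -> R) (u v : 'I_n -> {fmonom 'I_t}),
    (forall i, homog_binom_in_ideal A (u i) (v i)) ->
    binom_diff w1 w2 = \sum_(i < n) a i * binom_diff (u i) (v i) * b i ->
    exists i, fdeg (u i) = fdeg w1 /\ fdeg (v i) = fdeg w1.

Definition minimal_binoms A p : Prop :=
  exists u v, minimal_disjoint_binom A u v /\ p = binom_diff u v.

Definition letter_commutators p : Prop :=
  exists i j : 'I_t, i != j /\
    p = mon (letter i) * mon (letter j) - mon (letter j) * mon (letter i).

End WeightIdeal.

(* Main.v *)
(** For a regular array, words of equal length have equal weight iff the
    products of the first-column entries of their letters agree, so weights
    ignore the order of the letters.  By induction on the length, [u - v] lies
    in the ideal generated by commutators and minimal binomials: a common
    letter of [u] and [v] can be moved to the front and cancelled; if the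
    supports are disjoint and [u - v] is not minimal, the component of degree
    [|u|] of an expression witnessing non-minimality only involves binomials
    of smaller degree.  Those have equal weights, since summing the coefficients
    of the words of given length and weight annihilates [I_A], so the induction
    hypothesis applies to them. *)
Require Import Defs.
From HB Require Import structures.
From mathcomp Require Import all_boot all_order all_algebra.
From mathcomp.multinomials Require Import monalg.
From Stdlib Require Import Classical_Prop.

Set Implicit Arguments.
Unset Strict Implicit.
Unset Printing Implicit Defensive.

Import Order.TTheory GRing.Theory Num.Theory.
Local Open Scope ring_scope.

(** * Congruences modulo a two-sided ideal *)

Lemma two_sided_ideal_sum (R : nzRingType) (J : R -> Prop) n (f : 'I_n -> R) :
  two_sided_ideal J -> (forall i, J (f i)) -> J (\sum_(i < n) f i).
Proof. by move=> [J0 JD _] Jf; apply: (big_ind J). Qed.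

Lemma two_sided_ideal_mulBr (R : nzRingType) (J : R -> Prop) a p q :
  two_sided_ideal J -> J (p - q) -> J (a * p - a * q).
Proof.
by move=> [_ _ JM] Jpq; rewrite -mulrBr -[a * _]mulr1; apply: JM.
Qed.

Lemma two_sided_ideal_mulBl (R : nzRingType) (J : R -> Prop) b p q :
  two_sided_ideal J -> J (p - q) -> J (p * b - q * b).
Proof.
by move=> [_ _ JM] Jpq; rewrite -mulrBl -[_ - _]mul1r; apply: JM.
Qed.

Lemma two_sided_ideal_subC (R : nzRingType) (J : R -> Prop) p q :
  two_sided_ideal J -> J (p - q) -> J (q - p).
Proof.
move=> [_ _ JM] Jpq; rewrite -opprB -mulN1r -[_ * _]mulr1.
exact: JM.
Qed.

Lemma two_sided_ideal_trans (R : nzRingType) (J : R -> Prop) q p r :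
  two_sided_ideal J -> J (p - q) -> J (q - r) -> J (p - r).
Proof.
by move=> [_ JD _] Jpq Jqr; rewrite -(subrK q p) -addrA; apply: JD.
Qed.

(** Modulo [J], [a * p] is congruent to [a * b * q], hence to [b * a * q]. *)
Lemma two_sided_ideal_swap (R : nzRingType) (J : R -> Prop) a b p q :
    two_sided_ideal J -> J (a * b - b * a) -> J (p - b * q) ->
  J (a * p - b * (a * q)).
Proof.
move=> Jid Jab Jpq; apply: (two_sided_ideal_trans (q := a * (b * q))) => //.
  exact: two_sided_ideal_mulBr.
by rewrite !mulrA; apply: two_sided_ideal_mulBl.
Qed.

Lemma two_sided_ideal_factor (R : nzRingType) (J : R -> Prop) a p q p' q' :
    two_sided_ideal J -> J (p - a * p') -> J (q - a * q') -> J (p' - q') ->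
  J (p - q).
Proof.
move=> Jid Jp Jq Jpq; apply: (two_sided_ideal_trans Jid Jp).
apply: (two_sided_ideal_trans Jid (two_sided_ideal_mulBr a Jid Jpq)).
exact: two_sided_ideal_subC.
Qed.

(** * Monomials and homogeneous components of the free algebra *)

Section Words.
Variables (k : fieldType) (t : nat).
Local Notation R := {malg k[{fmonom 'I_t}]}.
Implicit Types (x y u v w : {fmonom 'I_t}) (a b p q : R) (n : nat).

Lemma monM u v : mon k (mmul u v) = mon k u * mon k v.
Proof. by rewrite malgM_def fgmulUU mulr1. Qed.

Lemma monalg_monC (c : k) w : << c *g w >> = c%:MP * mon k w :> R.
Proof. by rewrite malgM_def fgmulUU mulr1 mul1m. Qed.

Lemma mon_sandwich (c d : k) x w y :
  << c *g x >> * mon k w * << d *g y >> =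
  << c * d *g mmul (mmul x w) y >> :> R.
Proof. by rewrite !malgM_def !fgmulUU mulr1. Qed.

Lemma binom_sandwich (c d : k) x u v y :
  << c *g x >> * binom_diff k u v * << d *g y >> =
  << c * d *g mmul (mmul x u) y >> - << c * d *g mmul (mmul x v) y >> :> R.
Proof.
rewrite /binom_diff -!mon_sandwich.
by rewrite (mulrBr << c *g x >> (mon k u)) (mulrBl << d *g y >> (_ * mon k u)).
Qed.

Lemma mon_cons i (s : seq 'I_t) :
  mon k (FMonom (i :: s)) = mon k (letter i) * mon k (FMonom s).
Proof.
by rewrite -monM; congr (mon k _); apply/eqP; rewrite fmP fmM fmU.
Qed.

(** Expanding [b], then [a], into monomials reduces arbitrary multipliers to monomial ones. It
    serves for [P] an ideal membership and for [P] the vanishing of a functional. *)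
Lemma additive_sandwich (V : zmodType) (P : V -> Prop) (F : {additive R -> V})
    (g : R) :
  P 0 -> (forall f h, P f -> P h -> P (f + h)) ->
  (forall c x d y, P (F (<< c *g x >> * g * << d *g y >>))) ->
  forall a b, P (F (a * g * b)).
Proof.
move=> P0 PD PF a b.
have PFb c x : P (F (<< c *g x >> * (g * b))).
  rewrite {1}(monalgE b) mulrA mulr_sumr raddf_sum.
  by apply: (big_ind P) => // y _.
rewrite -mulrA; move: (g * b) PFb => h PFh.
rewrite {1}(monalgE a) mulr_suml raddf_sum.
by apply: (big_ind P) => // x _.
Qed.

Definition homog_part n : R -> R :=
  mmap (@malgC {fmonom 'I_t} k) (fun w => if fdeg w == n then mon k w else 0).

HB.instance Definition _ n := GRing.Additive.copy (homog_part n)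
  (mmap (@malgC {fmonom 'I_t} k) (fun w => if fdeg w == n then mon k w else 0)).

Lemma homog_partU n (c : k) w :
  homog_part n << c *g w >> = if fdeg w == n then << c *g w >> else 0.
Proof.
rewrite /homog_part mmapU.
by case: (fdeg w == n); [rewrite -monalg_monC | rewrite mulr0].
Qed.

Lemma homog_part_binom n u v : fdeg u = fdeg v ->
  homog_part n (binom_diff k u v) =
  if fdeg u == n then binom_diff k u v else 0.
Proof.
move=> uv; rewrite /binom_diff raddfB /= !homog_partU uv.
by case: (fdeg v == n); [exact: erefl | exact: subrr].
Qed.

(** For monomial multipliers the product is homogeneous, so its component is zero or the whole
    product. In the latter case [fdeg u <= n], and strictly since [fdeg u != n]. *)
Lemma homog_part_sandwich (J : R -> Prop) n u v a b :
    two_sided_ideal J -> fdeg u = fdeg v -> fdeg u != n ->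
    ((fdeg u < n)%N -> J (binom_diff k u v)) ->
  J (homog_part n (a * binom_diff k u v * b)).
Proof.
move=> Jid uv un Juv; case: (Jid) => J0 JD JM.
move: a b; apply: additive_sandwich => // c x d y.
have := JM << c *g x >> _ << d *g y >> (Juv _).
rewrite binom_sandwich raddfB /= !homog_partU !fdegM -uv => Jxy.
case: eqP => [eqn|_]; last by rewrite subrr.
apply: Jxy.
by rewrite ltn_neqAle un -eqn addnAC leq_addl.
Qed.

(** * Reordering letters modulo commutators *)

Section ModuloCommutators.
Variable J : R -> Prop.
Hypotheses (Jid : two_sided_ideal J)
           (Jcomm : forall p, letter_commutators p -> J p).

Lemma letter_swap i j :
  J (mon k (letter i) * mon k (letter j) - mon k (letter j) * mon k (letter i)).
Proof.
have [->|ij] := eqVneq i j; first by rewrite subrr; case: Jid.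
by apply: Jcomm; exists i, j.
Qed.

(** The first occurrence of [i], the one that [rem] deletes, is swapped past each letter before
    it. *)
Lemma letter_to_front i (s : seq 'I_t) : i \in s ->
  J (mon k (FMonom s) - mon k (letter i) * mon k (FMonom (rem i s))).
Proof.
elim: s => // j s IHs; rewrite inE /= mon_cons eq_sym.
have [->|ji] /= := eqVneq j i; first by rewrite subrr; case: Jid.
move=> /IHs Js; rewrite mon_cons.
exact: two_sided_ideal_swap Jid (letter_swap _ _) Js.
Qed.

End ModuloCommutators.
End Words.

(** * Weights for a regular array *)

Section RegularWeights.
Variables (S : realFieldType) (t : nat) (A : 'I_t -> nat -> S).
Hypotheses (A_gt0 : forall i j, 0 < A i j) (A_regular : regular_array A).
Implicit Types u v w x y : {fmonom 'I_t}.

Definition base_weight (s : seq 'I_t) : S := \prod_(i <- s) A i 0%N.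

Lemma base_weight_cat s1 s2 :
  base_weight (s1 ++ s2) = base_weight s1 * base_weight s2.
Proof. exact: big_cat. Qed.

Lemma base_weight_rem i s : i \in s ->
  base_weight s = A i 0%N * base_weight (rem i s).
Proof.
by move=> i_s; rewrite /base_weight (perm_big _ (perm_to_rem i_s)) big_cons.
Qed.

(** By regularity [A i0 j / A i0 0] is the scalar taking column 0 to column [j], whatever the row
    [i0]. *)
Lemma weight_base (i0 : 'I_t) w :
  weight A w = (\prod_(j < size w) (A i0 j / A i0 0%N)) * base_weight w.
Proof.
rewrite /weight /base_weight big_tnth -big_split /=; apply: eq_bigr => j _.
have [c cE] := A_regular j; rewrite cE (cE i0).
by rewrite mulfK // gt_eqF.
Qed.

(** The positional factor in [weight_base] depends only on the length and is nonzero, so it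
    cancels. *)
Lemma eq_weight u v : size u = size v ->
  weight A u = weight A v <-> base_weight u = base_weight v.
Proof.
(* The first letter of [u] supplies the row [i0]; empty words are treated apart. *)
case: u v => [[|i0 u]] v uv.
  by move/esym/size0nil: uv => v0; rewrite /weight v0 !big_ord0 /=.
rewrite !(weight_base i0) uv; split=> [|-> //]; apply: mulfI.
by apply/prodf_neq0 => j _; rewrite gt_eqF // divr_gt0.
Qed.

Lemma eq_weight_mul u v x y : size u = size v -> weight A u = weight A v ->
  weight A (mmul (mmul x u) y) = weight A (mmul (mmul x v) y).
Proof.
move=> uv /(eq_weight uv) wuv; apply/eq_weight.
  by rewrite !fmM !size_cat uv.
by rewrite !fmM !base_weight_cat wuv.
Qed.

Section WeightIdealRegular.
Variable k : fieldType.
Local Notation R := {malg k[{fmonom 'I_t}]}.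

Definition weight_part n s : R -> k :=
  mmap idfun (fun w => ((fdeg w == n) && (weight A w == s))%:R).

HB.instance Definition _ n s := GRing.Additive.copy (weight_part n s)
  (mmap idfun (fun w => ((fdeg w == n) && (weight A w == s))%:R)).

Lemma weight_partU n s c w :
  weight_part n s << c *g w >> = c * ((fdeg w == n) && (weight A w == s))%:R.
Proof. exact: mmapU. Qed.

(** Multiplying a generator by monomials on both sides gives two words of equal length and weight,
    whose coefficients cancel. *)
Lemma weight_ideal_part p n s : weight_ideal A p -> weight_part n s p = 0.
Proof.
move=> [m [a [g [b [Gg ->]]]]]; rewrite raddf_sum big1 // => i _.
have [u [v [_ _ uv wuv ->]]] := Gg i; move: (a i) (b i).
apply: (additive_sandwich (P := eq^~ 0)) => // [f h -> ->|c x d y].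
  by rewrite addr0.
rewrite binom_sandwich raddfB /= !weight_partU !fdegM uv.
by rewrite (eq_weight_mul _ _ uv wuv) subrr.
Qed.

Lemma weight_ideal_eq_weight u v : fdeg u = fdeg v ->
  weight_ideal A (binom_diff k u v) -> weight A u = weight A v.
Proof.
move=> uv /(weight_ideal_part (fdeg u) (weight A u)).
rewrite raddfB /= !weight_partU uv !eqxx !mul1r /=.
case: eqP => [->//|_ /eqP]; first by rewrite subr0 oner_eq0.
Qed.

Lemma weight_ideal_binom u v : fdeg u = fdeg v -> weight A u = weight A v ->
  weight_ideal A (binom_diff k u v).
Proof.
(* Generators exclude the empty word; there the difference is 0. *)
move=> uv wuv; have [u1|u1] := eqVneq u mone.
  have v1 : v = mone by apply: fdeg_eq0I; rewrite -uv u1 fdeg1.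
  rewrite u1 v1 /binom_diff subrr.
  by case: (ideal_generated_ideal (weight_generator (k := k) A)).
apply: ideal_generated_sub; exists u, v; split=> //.
by rewrite -fdeg_eq0 -uv fdeg_eq0.
Qed.

Lemma letter_commutator_weight_ideal (p : R) :
  letter_commutators p -> weight_ideal A p.
Proof.
move=> [i [j [_ ->]]]; rewrite -!monM; apply: weight_ideal_binom.
  by rewrite !fdegM !fdegU.
apply/eq_weight; first by rewrite !fmM !fmU.
by rewrite !fmM !fmU !base_weight_cat mulrC.
Qed.

Lemma nonminimal_homog_part (J : R -> Prop) u v :
    two_sided_ideal J -> disjoint_binom k A u v ->
    (forall u' v', homog_binom_in_ideal k A u' v' -> (fdeg u' < fdeg u)%N ->
       J (binom_diff k u' v')) ->
  ~ minimal_disjoint_binom k A u v -> J (binom_diff k u v).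
Proof.
move=> Jid duv IH nmin; have [[uv _] _] := duv; apply: NNPP => nJ.
apply: nmin; split=> // n a b u' v' h' E; apply: NNPP => nex; apply: nJ.
(* Only the components of degree [fdeg u] of the terms of the expression matter. *)
have <- : homog_part (fdeg u) (binom_diff k u v) = binom_diff k u v.
  by rewrite homog_part_binom ?eqxx.
rewrite E raddf_sum; apply: two_sided_ideal_sum => // i.
have [uv' _] := h' i; apply: homog_part_sandwich => //.
  by apply/eqP => eq_u; apply: nex; exists i; rewrite -uv'.
exact: IH.
Qed.

Lemma binom_in_generated (J : R -> Prop) u v : two_sided_ideal J ->
    (forall p, letter_commutators p -> J p) ->
    (forall p, minimal_binoms A p -> J p) ->
  fdeg u = fdeg v -> weight A u = weight A v -> J (binom_diff k u v).
Proof.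
move=> Jid Jcomm Jmin; have [n] := ubnP (fdeg u).
elim: n u v => // n IHn u v /ltnSE un uv wuv.
have [duv|/set0Pn[i]] := eqVneq (supp u :&: supp v) set0.
  have [min|] := classic (minimal_disjoint_binom k A u v).
    by apply: Jmin; exists u, v.
  apply: nonminimal_homog_part => //.
    by split=> //; split=> //; apply: weight_ideal_binom.
  move=> u' v' [uv' Iuv'] ltu'; apply: IHn => //.
    exact: leq_trans ltu' un.
  exact: weight_ideal_eq_weight Iuv'.
(* A common letter [i] is brought to the front of both words and cancelled. *)
rewrite !inE => /andP[iu iv].
have Ju := letter_to_front Jid Jcomm iu; rewrite fmK in Ju.
have Jv := letter_to_front Jid Jcomm iv; rewrite fmK in Jv.
have uv' : size (rem i u) = size (rem i v) by rewrite !size_rem // -!fdegE uv.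
apply: (two_sided_ideal_factor Jid Ju Jv); apply: IHn => //.
  rewrite fdegE /= size_rem // (leq_trans _ un) // fdegE prednK //.
  by case: (u : seq _) iu.
(* Deleting [i] shifts positions, so weights are compared through [base_weight], where the factor
   [A i 0] cancels. *)
apply/eq_weight => //=; apply: (@mulfI _ (A i 0%N)); first by rewrite gt_eqF.
by rewrite -!base_weight_rem //; apply/eq_weight.
Qed.

End WeightIdealRegular.
End RegularWeights.

Theorem theorem19 (k : fieldType) (S : realFieldType) (t : nat)
    (t_ge1 : (1 <= t)%N)
    (A : 'I_t -> nat -> S) (A_gt0 : forall i j, 0 < A i j)
    (A_nondegenerate : nondegenerate_array A) (A_regular : regular_array A)
    (p : {malg k[{fmonom 'I_t}]}) :
  weight_ideal A p <->
  ideal_generated (fun q : {malg k[{fmonom 'I_t}]} =>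
                     letter_commutators q \/ minimal_binoms A q) p.
Proof.
split; apply: ideal_generated_min => {p}; try exact: ideal_generated_ideal.
  move=> p [u [v [_ _ uv wuv ->]]].
  apply: (binom_in_generated A_gt0 A_regular) => //.
  - exact: ideal_generated_ideal.
  - by move=> q Gq; apply: ideal_generated_sub; left.
  - by move=> q Gq; apply: ideal_generated_sub; right.
move=> p [|[u [v [[[[_ Iuv] _] _] ->]]]] //.
exact: letter_commutator_weight_ideal.
Qed.
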